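(* Let $G$ be a finite simple connected graph that is not regular. Then every proper edge colouring $w$ of $G$ is sequentially orderable, i.e. there is a total order $\prec$ on $E(G)$ such that $f_{\prec}(u)\neq f_{\prec}(v)$ for every edge $uv\in E(G)$.
   Context: An edge colouring (edge weighting) is a map $w:E(G)\to\mathcal C$ into an arbitrary set $\mathcal C$ of colours; it is proper if any two distinct edges sharing an endpoint receive distinct colours. Given a total order $\prec$ on $E(G)$, the vertex colouring induced by $w$ and $\prec$ assigns to each vertex $v$ of degree $d(v)$ the finite sequence $f_{\prec}(v)=(w(e_1),\dots,w(e_{d(v)}))$, where $e_1\prec\dots\prec e_{d(v)}$ are all the edges incident with $v$. The colouring $w$ is called sequentially orderable if there is a total order $\prec$ on $E(G)$ for which $f_{\prec}$ is a proper vertex colouring, i.e. $f_{\prec}(u)\ne f_{\prec}(v)$ for all adjacent $u,v$ (sequences of different lengths are different). *)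

(* Defs.v *)
From mathcomp Require Import all_boot.

Set Implicit Arguments.
Unset Strict Implicit.
Unset Printing Implicit Defensive.

Record sgraph := SGraph {
  vertex :> finType;
  adj : rel vertex;
  adj_sym : symmetric adj;
  adj_irrefl : irreflexive adj
}.

Definition edge_set (G : sgraph) : {set {set G}} :=
  [set [set p.1; p.2] | p : G * G & adj p.1 p.2].

(* The finite type E(G) of edges; an edge is a two-element set of vertices. *)
Definition edge (G : sgraph) : finType := {x : {set G} | x \in edge_set G}.

Definition incident (G : sgraph) (v : G) : {set edge G} :=
  [set x : edge G | v \in sval x].

Definition degree (G : sgraph) (v : G) : nat := #|incident v|.

Definition connected_graph (G : sgraph) : Prop :=
  forall u v : G, connect (@adj G) u v.

Definition regular_graph (G : sgraph) : Prop :=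
  exists d : nat, forall v : G, degree v = d.

Definition proper_edge_colouring (G : sgraph) (C : Type) (w : edge G -> C) :
    Prop :=
  forall (x y : edge G) (v : G),
    x != y -> x \in incident v -> y \in incident v -> w x <> w y.

(* Orders are given by their reflexive (non-strict) version. *)
Definition total_order (T : Type) (r : rel T) : Prop :=
  [/\ reflexive r, antisymmetric r, transitive r & total r].

(* When [r] is a total order, [sort r] lists the edges incident with [v]
   in increasing order, without repetition. *)
Definition induced_colouring (G : sgraph) (C : Type) (w : edge G -> C)
    (r : rel (edge G)) (v : G) : seq C :=
  [seq w x | x <- sort r (enum (incident v))].

Definition sequentially_orderable (G : sgraph) (C : Type) (w : edge G -> C) :
    Prop :=
  exists2 r : rel (edge G), total_order r &
    forall u v : G,
      adj u v -> induced_colouring w r u <> induced_colouring w r v.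

(* Main.v *)
(** Edges joining vertices of different degrees are ordered first, arbitrarily; the others
    are inserted one vertex at a time, so that [code v], the sequence of colours of the
    edges at [v] inserted so far, is final once all edges at [v] are in.  Two adjacent
    vertices already differ if their common edge has different ranks in their codes, or if
    their codes differ before that edge.

    Among the vertices of a component of the graph of missing edges, complete one, [v],
    with the fewest missing edges (all degrees in the component are equal, so [v] has the
    longest code), appending its missing edges.  At a neighbour [u], the new edge gets rank
    [size (code u) + 1], at most its rank at [v], with equality only if it is the first
    edge appended and the codes have equal lengths; so it suffices that the first appended
    edge leads to a vertex whose code is shorter than, or different from, that of [v].  If
    there is no such [v], all codes in the component coincide.  Then take the latest edge
    [H = xt] meeting the component, with [x] in it, and insert a missing edge [xy] just
    before [H]: this gives [xy] different ranks at [x] and [y], and of two choices for [y]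
    at least one keeps the code of [x] different from that of [t].

    There is a choice of [y] unless the component is a single edge, and the bad case
    arises only at the end of paths.  The predicate [trap] describes it, and the invariant
    says that a trap can occur only in a component that is not a path, or that has
    vertices whose codes differ early.  If a component is a path with equal codes, its
    leaves other than [x] are completed by inserting their edges just before [H], which
    keeps [H] the latest edge. *)

Require Import Defs.
From Stdlib Require Import ClassicalEpsilon.
From mathcomp Require Import all_boot zify.

Set Implicit Arguments.
Unset Strict Implicit.
Unset Printing Implicit Defensive.

(** Cuts a list at its last member satisfying [p]; this is how the latest edge of a component is
    located in the order. *)
Lemma rcons_filter_split (T : Type) (p : pred T) (s B : seq T) (x : T) :
  filter p s = rcons B x ->
  exists s1 s2, [/\ s = s1 ++ x :: s2, filter p s1 = B & filter p s2 = [::]].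
Proof.
elim/last_ind: s => [|s y IH]; first by case: B.
rewrite filter_rcons; case: ifP => py.
  by move/rcons_inj => [<- <-]; exists s, [::]; rewrite cats1.
case/IH=> s1 [s2 [-> <- s20]]; exists s1, (rcons s2 y).
by rewrite rcons_cat filter_rcons py.
Qed.

(** * Edges and partial orders *)

Section Edges.
Variable G : sgraph.
Implicit Types (e f : edge G) (u v x y : G).

Definition ends e : {set G} := sval e.
Definition joins e u v := ends e == [set u; v].

Lemma joins_sym e u v : joins e u v = joins e v u.
Proof. by rewrite /joins setUC. Qed.

Lemma edge_ends e : exists u v, adj u v && joins e u v.
Proof.
by case/imsetP: (valP e) => -[u v]; rewrite inE /= => uv Ee; exists u, v; rewrite uv /joins /ends Ee eqxx.
Qed.

Lemma adj_joins u v : adj u v -> exists e, joins e u v.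
Proof.
move=> uv.
have uvE : [set u; v] \in edge_set G by apply/imsetP; exists (u, v); rewrite ?inE /=.
by exists (exist (fun x : {set G} => x \in edge_set G) _ uvE); rewrite /joins /=.
Qed.

Lemma joins_in e u v x : joins e u v -> (x \in ends e) = (x == u) || (x == v).
Proof. by move/eqP->; rewrite !inE. Qed.

Lemma joins_neq e u v : joins e u v -> u != v.
Proof.
case: (edge_ends e) => a [b /andP [ab /eqP Ee]]; apply: contraTneq => ->.
rewrite /joins Ee setUid; apply: contraTN ab => /eqP/setP Eab.
have /set1P-> : a \in [set v] by rewrite -Eab !inE eqxx.
have /set1P-> : b \in [set v] by rewrite -Eab !inE eqxx orbT.
by rewrite adj_irrefl.
Qed.

Lemma in_joins e u : u \in ends e -> exists v, joins e u v.
Proof.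
case: (edge_ends e) => a [b /andP [_ ab]]; rewrite (joins_in _ ab).
by case/orP => /eqP->; [exists b | exists a; rewrite joins_sym].
Qed.

Lemma joins_edge_inj e f u v : joins e u v -> joins f u v -> e = f.
Proof. by move=> /eqP Ee /eqP Ef; exact: val_inj (etrans Ee (esym Ef)). Qed.

Lemma joins_inl e u v : joins e u v -> u \in ends e.
Proof. by move/joins_in->; rewrite eqxx. Qed.

Lemma joins_inr e u v : joins e u v -> v \in ends e.
Proof. by move/joins_in->; rewrite eqxx orbT. Qed.

Lemma joins_end e u v x : joins e u v -> joins e u x -> v = x.
Proof.
move=> uv ux; have := joins_inr uv.
by rewrite (joins_in _ ux) eq_sym (negPf (joins_neq uv)) => /eqP.
Qed.

Lemma in2_joins e u v :
  u \in ends e -> v \in ends e -> u != v -> joins e u v.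
Proof.
move=> /in_joins [a ua]; rewrite (joins_in _ ua) eq_sym.
by case: eqP => //= _ /eqP->.
Qed.

Section PartialOrders.
(* A list of edges without repetition stands for a linear order on its members. *)
Implicit Type L : seq (edge G).

Definition back L v := [seq e <- L | v \in ends e].
Definition live L v := [seq e <- enum (incident v) | e \notin L].
Definition link L u v := [exists e, (e \notin L) && joins e u v].
Definition linked L := connect (link L).

Lemma mem_back L v e : (e \in back L v) = (v \in ends e) && (e \in L).
Proof. by rewrite mem_filter. Qed.

Lemma mem_live L v e : (e \in live L v) = (e \notin L) && (v \in ends e).
Proof. by rewrite mem_filter mem_enum inE. Qed.

Lemma live_uniq L v : uniq (live L v).
Proof. by rewrite filter_uniq // enum_uniq. Qed.

Lemma back_cat L1 L2 v : back (L1 ++ L2) v = back L1 v ++ back L2 v.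
Proof. exact: filter_cat. Qed.

Lemma back_uniq L v : uniq L -> uniq (back L v).
Proof. exact: filter_uniq. Qed.

Lemma live_nil L v : (live L v = [::]) <-> (forall e, v \in ends e -> e \in L).
Proof.
split=> [lv e ve|lv].
  by apply: contraT => eL; suff: e \in live L v; [rewrite lv|rewrite mem_live eL].
apply/eqP; rewrite -[_ == _]negbK -has_filter; apply/hasPn => e.
by rewrite mem_enum inE => /lv; rewrite negbK.
Qed.

Lemma size_back_live L v : uniq L -> size (back L v) + size (live L v) = degree v.
Proof.
move=> uL; rewrite /degree cardE -[RHS](count_predC (mem L)) -!size_filter; congr (_ + _).
apply: perm_size; apply: uniq_perm => [||e]; first exact: back_uniq.
  exact/filter_uniq/enum_uniq.
by rewrite mem_back [RHS]mem_filter mem_enum !inE andbC.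
Qed.

Lemma linkP L u v : reflect (exists2 e, e \notin L & joins e u v) (link L u v).
Proof.
by apply: (iffP existsP) => [[e /andP []]|[e eL eJ]]; exists e; rewrite ?eL.
Qed.

Lemma link_sym L : symmetric (link L).
Proof. by move=> u v; apply: eq_existsb => e; rewrite joins_sym. Qed.

Lemma linked_sym L u v : linked L u v = linked L v u.
Proof. exact/sym_connect_sym/link_sym. Qed.

Lemma live_link L u e : e \in live L u -> exists2 v, joins e u v & link L u v.
Proof.
rewrite mem_live => /andP [eL /in_joins [v uv]]; exists v => //.
by apply/linkP; exists e.
Qed.

Lemma link_live L u v : link L u v -> exists2 e, joins e u v & e \in live L u.
Proof.
by case/linkP=> e eL uv; exists e => //; rewrite mem_live eL (joins_inl uv).
Qed.

Lemma linked_trans L u v x : linked L u v -> linked L v x -> linked L u x.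
Proof. exact: connect_trans. Qed.

Lemma linked_live L u v : linked L u v -> u != v -> live L u != [::].
Proof.
case/connectP => -[_ /= -> |z p /= /andP [/link_live [e _ eu] _] _ _].
  by rewrite eqxx.
by case: (live L u) eu.
Qed.

(* [v] becomes complete while the relative order of the old edges is kept. *)
Definition completes L L' v :=
  [/\ uniq L', [seq e <- L' | e \in L] = L &
      forall e, (e \in L') = (e \in L) || (v \in ends e)].

(** * The effect of completing one vertex on the other vertices *)

Section Completes.
Variables (L L' : seq (edge G)) (v : G).
Hypothesis LL' : completes L L' v.

(** Every new edge contains [v], so by hypothesis none satisfies [p]; the old edges keep their
    order. *)
Lemma completes_filter (p : pred (edge G)) :
  (forall e, p e -> v \in ends e -> e \in L) -> filter p L' = filter p L.
Proof.
case: LL' => _ LE L'E pL; rewrite -[in RHS]LE -filter_predI.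
apply: eq_in_filter => e; rewrite L'E /=; case eL: (e \in L); rewrite ?andbT //=.
by move=> ve; rewrite andbF; apply/negP => pe; move: (pL e pe ve); rewrite eL.
Qed.

Lemma completes_live : live L' v = [::].
Proof. by apply/live_nil => e ve; case: LL' => _ _ ->; rewrite ve orbT. Qed.

Lemma completes_back u : u != v -> ~~ link L u v -> back L' u = back L u.
Proof.
move=> uv luv; apply: completes_filter => e ue ve; apply: contraNT luv => eL.
by apply/linkP; exists e; last apply: in2_joins.
Qed.

Lemma completes_live_filter u : live L' u = [seq e <- live L u | v \notin ends e].
Proof.
rewrite /live -[RHS]filter_predI; apply: eq_filter => e /=.
by case: LL' => _ _ ->; rewrite negb_or andbC.
Qed.

Lemma completes_live_far u : u != v -> ~~ link L u v -> live L' u = live L u.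
Proof.
move=> uv luv; rewrite completes_live_filter; apply/all_filterP/allP => e.
rewrite mem_live => /andP [eL ue]; apply: contraNN luv => ve.
by apply/linkP; exists e; last apply: in2_joins.
Qed.

Lemma completes_live_done u : live L u = [::] -> live L' u = [::].
Proof. by rewrite completes_live_filter => ->. Qed.

Lemma completes_back_done u : live L u = [::] -> back L' u = back L u.
Proof. by move/live_nil => lu; apply: completes_filter => e /lu. Qed.

(** The graph is simple, so [u] loses exactly one missing edge. *)
Lemma completes_live_near u : link L u v -> size (live L u) = (size (live L' u)).+1.
Proof.
case/linkP => e eL uv; rewrite completes_live_filter -[RHS]add1n.
rewrite -[in LHS](count_predC (fun e => v \in ends e)) -!size_filter; congr (_ + _).
apply: (@perm_size _ _ [:: e]); apply: uniq_perm => //.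
  exact/filter_uniq/live_uniq.
move=> f; rewrite mem_filter mem_live inE.
apply/andP/eqP => [[vf /andP [_ uf]]|->]; last first.
  by rewrite (joins_inr uv) eL (joins_inl uv).
exact: joins_edge_inj (in2_joins uf vf (joins_neq uv)) uv.
Qed.

Lemma completes_link a b : link L' a b = [&& link L a b, a != v & b != v].
Proof.
apply/linkP/and3P => [[e]|[/linkP [e eL ab] av bv]].
  case: LL' => _ _ ->; rewrite negb_or => /andP [eL ve] ab; split.
  - by apply/linkP; exists e.
  - by apply: contraNneq ve => <-; apply: joins_inl ab.
  - by apply: contraNneq ve => <-; apply: joins_inr ab.
exists e => //; case: LL' => _ _ ->; rewrite negb_or eL (joins_in _ ab).
by rewrite negb_or ![v == _]eq_sym av bv.
Qed.

Lemma completes_linked a b : linked L' a b -> linked L a b.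
Proof.
by apply: connect_sub => x y; rewrite completes_link => /and3P [xy _ _]; apply: connect1.
Qed.

(** A path outside the component of [v] never visits [v], so all its links survive. *)
Lemma completes_linked_far a b : ~~ linked L a v -> linked L a b -> linked L' a b.
Proof.
move=> av /connectP [p pp ->]; elim: p a av pp => [|c p IH] a av /=.
  by rewrite /linked connect0.
case/andP => ac pp; have cv : ~~ linked L c v.
  by apply: contraNN av; apply: connect_trans (connect1 ac).
apply: connect_trans (IH c cv pp); apply: connect1; rewrite completes_link ac /=.
by apply/andP; split; [apply: contraNneq av|apply: contraNneq cv] => ->; apply: connect0.
Qed.

(** A repetition-free path from [v] to [a] avoids [v] after its first step, so it survives from its
    second vertex [z] on. *)
Lemma completes_linked_near a :
  linked L v a -> a != v -> exists2 z, link L v z & linked L' z a.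
Proof.
case/connectP => p0 pp0 ->; case/shortenP: pp0 => -[|z p] //=; rewrite ?eqxx //.
move=> /andP [vz pp] /andP [vp _] _ _; exists z => //.
apply/connectP; exists p => //; elim: p z pp vp {vz} => //= y p IH z /andP [zy pp].
rewrite inE negb_or => /andP [vz vyp]; rewrite IH // completes_link zy /=.
by move: vyp; rewrite inE negb_or eq_sym [z == v]eq_sym vz => /andP [->].
Qed.

End Completes.

End PartialOrders.
End Edges.

Lemma index_take_eq (T : eqType) (x : T) (s1 s2 : seq T) :
  x \in s1 -> take (index x s1).+1 s2 = take (index x s1).+1 s1 ->
  index x s2 = index x s1.
Proof.
move=> x1 E; have xt : x \in take (index x s1).+1 s1.
  by rewrite in_take_leq ?index_mem.
by rewrite -[in RHS](cat_take_drop (index x s1).+1 s1) -[in LHS](cat_take_drop (index x s1).+1 s2)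
  E !index_cat xt.
Qed.

(** * The invariant *)

Section Colouring.
Variables (G : sgraph) (C : eqType) (w : edge G -> C).
Hypothesis wP : proper_edge_colouring w.
Implicit Types (L : seq (edge G)) (e f g h : edge G) (u v x y : G).

Lemma proper_inj v e f : v \in ends e -> v \in ends f -> w e = w f -> e = f.
Proof.
move=> ve vf; apply: contra_eq => ef; apply/eqP.
by apply: (wP (v := v)) => //; rewrite inE.
Qed.

Definition code L v := [seq w e | e <- back L v].

(* The codes of [v] and of the complete vertex [q] differ at the latest at the position
   of [e] in [back L v]; this cannot be undone by edges inserted at [v] after [e]. *)
Definition separates L e q v :=
  let i := (index e (back L v)).+1 in
  (live L q == [::]) && (take i (code L v) != take i (code L q)).

Lemma separates_neq L e q v : separates L e q v -> code L q <> code L v.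
Proof. by case/andP => _ /eqP E Eq; apply: E; rewrite Eq. Qed.

(** The code of the complete vertex [q] is frozen, so it is enough that [v] keeps its edges up to
    [e]. *)
Lemma separates_completes L L' x e q v :
  completes L L' x -> e \in back L v -> separates L e q v ->
  take (index e (back L v)).+1 (back L' v) = take (index e (back L v)).+1 (back L v) ->
  separates L' e q v.
Proof.
move=> LL' ev /andP [/eqP lq ne] E; rewrite /separates (index_take_eq ev E).
rewrite (completes_live_done LL' lq) eqxx /=; move: ne.
by rewrite /code (completes_back_done LL' lq) -!map_take E.
Qed.

(** If the prefixes agreed, the edge of [q] at the rank that [e] has at [v] would have the colour of
    [e]. Both edges contain [q], so properness makes them equal, and so are the ranks. *)
Lemma separates_rank L e q v :
  uniq L -> e \in back L v -> e \in back L q -> live L q = [::] ->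
  index e (back L v) != index e (back L q) -> separates L e q v.
Proof.
move=> uL ev eq lq; rewrite /separates lq eqxx /=; apply: contraNneq.
set i := index e (back L v) => E.
have iv : i < size (back L v) by rewrite index_mem.
have iq : i < size (back L q).
  by move/(congr1 size): E; rewrite !size_take_min !size_map; lia.
have := congr1 (fun s => nth (w e) s i) E.
rewrite !nth_take // !(nth_map e) // nth_index // => Ew.
have nq : nth e (back L q) i \in back L q by rewrite mem_nth.
have -> : e = nth e (back L q) i.
  apply: (@proper_inj q) Ew; first by move: eq; rewrite mem_back => /andP [].
  by move: nq; rewrite mem_back => /andP [].
by rewrite index_uniq ?back_uniq.
Qed.

Definition touching L x := [seq e <- L | [exists u, linked L x u && (u \in ends e)]].

(* [x] has one missing edge [g], the latest edge [H] of its component is at [x], and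
   inserting [g] just before [H] would give [x] the code of the other end of [H]. *)
Definition trap L x :=
  exists A B H g t,
    [/\ touching L x = rcons B H, back L x = rcons A H, live L x = [:: g],
        joins H x t /\ degree x = degree t &
        code L t = [seq w e | e <- A] ++ [:: w g; w H]].

(* For a leaf [x] without the first alternative the component is a path, so it has a second
   leaf and the last alternative fails; allowing it avoids any argument about paths. *)
Definition escape L x :=
  [|| [exists u, linked L x u && (2 < size (live L u))],
      [exists u, linked L x u &&
         (take (degree x - 2) (code L u) != take (degree x - 2) (code L x))] |
      [forall u, linked L x u && (size (live L u) == 1) ==> (u == x)]].

(** [inv_separates] leaves out edges with ends of different degrees, whose final codes differ in
    length. [inv_back] gives each component that has missing edges a latest inserted edge [H]. *)
Record invariant L : Prop := Invariant {
  inv_uniq : uniq L;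
  inv_separates : forall e u v, e \in L -> joins e u v -> degree u = degree v ->
    separates L e u v || separates L e v u;
  inv_degree : forall e u v, e \notin L -> joins e u v -> degree u = degree v;
  inv_back : forall v, live L v != [::] -> exists2 u, linked L v u & back L u != [::];
  inv_trap : forall x, trap L x -> escape L x }.

Lemma inv_linked_degree L u v : invariant L -> linked L u v -> degree u = degree v.
Proof.
move=> IL /connectP [p pp ->]; elim: p u pp => //= a p IH u /andP [/linkP [e eL ua] /IH <-].
exact: (inv_degree IL eL ua).
Qed.

Lemma inv_separates_live L e u v :
  invariant L -> e \in L -> joins e u v -> degree u = degree v ->
  live L v != [::] -> separates L e u v.
Proof.
by move=> IL eL uv duv lv; case/orP: (inv_separates IL eL uv duv) => // /andP [];
  rewrite (negPf lv).
Qed.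

(** Linked ends would have equal degrees, so one of them would be complete by [inv_separates]; but
    distinct linked vertices both have missing edges. *)
Lemma inv_not_linked L e u v :
  invariant L -> e \in L -> joins e u v -> linked L u v = false.
Proof.
move=> IL eL uv; apply/negP => luv.
have luv' : linked L v u by rewrite linked_sym.
have := inv_separates IL eL uv (inv_linked_degree IL luv).
have uv' := joins_neq uv; rewrite /separates (negPf (linked_live luv uv')).
by rewrite (negPf (linked_live luv' _)) // eq_sym.
Qed.

(** * Reduction of the invariant to the component of the completed vertex *)

Section Completion.
Variables (L L' : seq (edge G)) (v : G).
Hypotheses (IL : invariant L) (LL' : completes L L' v).

Let links e u : e \notin L -> joins e v u -> link L v u.
Proof. by move=> eL vu; apply/linkP; exists e. Qed.

Lemma unlinked_neq x u : ~~ linked L x v -> linked L x u -> u != v.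
Proof. by move=> xv; apply: contraTneq => ->. Qed.

Lemma unlinked_link x u : ~~ linked L x v -> linked L x u -> ~~ link L u v.
Proof.
move=> xv xu; apply: contraNN xv => uv.
exact: connect_trans xu (connect1 uv).
Qed.

Lemma unlinked_completes x u : ~~ linked L x v -> linked L' x u = linked L x u.
Proof.
move=> xv; apply/idP/idP; first exact: (completes_linked LL').
exact: (completes_linked_far LL').
Qed.

(** Nothing changes in a component without [v], and the outer end [t] of [H] was already complete in
    [L], so its code is the old one. *)
Lemma trap_unlinked x : ~~ linked L x v -> trap L' x -> trap L x.
Proof.
move=> xv [A [B [H [g [t [TE BE LE [xt dxt] Ct]]]]]].
have xx : linked L x x by apply: connect0.
have xnv := unlinked_neq xv xx; have nxv := unlinked_link xv xx.
rewrite (completes_back LL' xnv nxv) in BE.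
rewrite (completes_live_far LL' xnv nxv) in LE.
have HL : H \in L.
  have: H \in back L x by rewrite BE mem_rcons inE eqxx.
  by rewrite mem_back => /andP [].
have lt : live L t = [::].
  have tx : joins H t x by rewrite joins_sym.
  have lx : live L x != [::] by rewrite LE.
  by case/andP: (inv_separates_live IL HL tx (esym dxt) lx) => /eqP.
exists A, B, H, g, t; split=> //; last first.
  by rewrite -Ct /code (completes_back_done LL' lt).
rewrite -TE; apply/esym; rewrite /touching.
under eq_filter => e do under eq_existsb => u do rewrite (unlinked_completes _ xv).
apply: (completes_filter LL') => e /existsP [u /andP [xu ue]] ve.
apply: contraNT (unlinked_link xv xu) => eL; rewrite link_sym.
apply: (@links e) => //; apply: in2_joins => //; rewrite eq_sym.
exact: unlinked_neq xu.
Qed.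

Lemma escape_unlinked x : ~~ linked L x v -> escape L x -> escape L' x.
Proof.
move=> xv; rewrite /escape.
have xx : linked L x x by apply: connect0.
have bE u : linked L x u -> code L' u = code L u.
  move=> xu; rewrite /code (completes_back LL') ?(unlinked_neq xv xu) //.
  exact: unlinked_link xu.
have lE u : linked L x u -> live L' u = live L u.
  move=> xu; rewrite (completes_live_far LL') ?(unlinked_neq xv xu) //.
  exact: unlinked_link xu.
case/or3P => [/existsP [u /andP [xu ku]]|/existsP [u /andP [xu cu]]|/forallP ux].
- by apply/or3P/Or31/existsP; exists u; rewrite (unlinked_completes _ xv) xu lE.
- by apply/or3P/Or32/existsP; exists u; rewrite (unlinked_completes _ xv) xu !bE.
apply/or3P/Or33/forallP => u; apply/implyP => /andP [].
rewrite (unlinked_completes _ xv) => xu; rewrite lE // => ku.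
by have := ux u; rewrite xu ku.
Qed.

Lemma invariant_completes :
  live L v != [::] ->
  (forall e a b, e \in L -> joins e a b -> degree a = degree b ->
    separates L e a b -> separates L' e a b) ->
  (forall e u, e \notin L -> joins e v u -> separates L' e v u) ->
  (forall x, linked L v x -> trap L' x -> escape L' x) ->
  invariant L'.
Proof.
move=> lv Hold Hnew Htrap; split.
- by case: LL'.
- move=> e a b; case: (LL') => _ _ ->; case: (boolP (e \in L)) => /= [eL _ ab dab|eL ve ab _].
    by case/orP: (inv_separates IL eL ab dab) => s;
      rewrite (Hold _ _ _ eL _ _ s) ?orbT // joins_sym.
  move: ve; rewrite (joins_in _ ab) => /orP [] /eqP va.
    by rewrite -va Hnew // va.
  by rewrite -va (Hnew _ _ eL) ?orbT // joins_sym va.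
- move=> e a b; case: (LL') => _ _ ->; rewrite negb_or => /andP [eL _].
  by move/(inv_degree IL): eL; apply.
- move=> a la.
  have av : a != v by apply: contraNneq la => ->; rewrite (completes_live LL').
  have la' : live L a != [::].
    by apply: contraNneq la => /(completes_live_done LL') ->.
  case: (boolP (linked L a v)) => alv.
    (* The component of [v] may fall apart, but each piece contains a neighbour [z] of [v], which
       has just received an edge. *)
    rewrite linked_sym in alv.
    have [z /linkP [e eL vz] za] := completes_linked_near LL' alv av.
    exists z; first by rewrite linked_sym.
    have: e \in back L' z.
      by case: (LL') => _ _ L'E; rewrite mem_back (joins_inr vz) L'E (joins_inl vz) orbT.
    by case: (back L' z).
  case: (inv_back IL la') => u au bu; exists u; first by rewrite unlinked_completes.
  by rewrite (completes_back LL') ?(unlinked_neq alv au) ?(unlinked_link alv au).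
- move=> x; case: (boolP (linked L x v)) => xv; first by apply: Htrap; rewrite linked_sym.
  by move/(trap_unlinked xv)/(inv_trap IL)/(escape_unlinked xv).
Qed.

End Completion.

(** * Completing a vertex *)

Section NewEdges.
Variables (L s : seq (edge G)) (v : G).
Hypotheses (uL : uniq L) (sv : perm_eq s (live L v)).

Lemma new_mem e : (e \in s) = (e \notin L) && (v \in ends e).
Proof. by rewrite (perm_mem sv) mem_live. Qed.

Lemma new_uniq : uniq s.
Proof. by rewrite (perm_uniq sv) live_uniq. Qed.

Lemma new_back e u : e \notin L -> joins e v u -> back s u = [:: e].
Proof.
move=> eL vu; apply: perm_small_eq => //; apply: uniq_perm => // [|f].
  exact/back_uniq/new_uniq.
rewrite mem_back new_mem inE; apply/idP/eqP => [/and3P [uf _ vf]|->].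
  exact: joins_edge_inj (in2_joins vf uf (joins_neq vu)) vu.
by rewrite (joins_inr vu) eL (joins_inl vu).
Qed.

Lemma new_back_center : back s v = s.
Proof. by apply/all_filterP/allP => e; rewrite new_mem => /andP []. Qed.

Lemma completes_perm L' : perm_eq L' (L ++ s) -> filter (mem L) L' = L -> completes L L' v.
Proof.
move=> pL' fL'; split=> // [|e].
  rewrite (perm_uniq pL') cat_uniq uL new_uniq andbT; apply/hasPn => e.
  by rewrite new_mem => /andP [].
by rewrite (perm_mem pL') mem_cat new_mem; case: (e \in L).
Qed.

Lemma filter_new : filter (mem L) s = [::].
Proof.
apply/eqP; rewrite -[_ == _]negbK -has_filter; apply/hasPn => e.
by rewrite new_mem => /andP [].
Qed.

End NewEdges.

Lemma filter_mem_subset (s L : seq (edge G)) : {subset s <= L} -> filter (mem L) s = s.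
Proof. by move=> sL; apply/all_filterP/allP. Qed.

Lemma cat_rcons_mem (T : eqType) (s1 s2 B : seq T) (x y : T) :
  s1 ++ s2 = rcons B x -> y \in s2 -> x \in s2.
Proof.
case/lastP: s2 => // s2 z; rewrite -rcons_cat => /rcons_inj [_ ->] _.
by rewrite mem_rcons mem_head.
Qed.

Lemma leaf_link L v x y :
  size (live L v) = 1 -> link L v x -> link L v y -> x = y.
Proof.
move=> lv /link_live [e vx ex] /link_live [f vy fy].
have ef : e = f by case: (live L v) lv ex fy => [|g []] //= _ /[!inE] /eqP -> /eqP.
by rewrite -ef in vy; apply: joins_end vy.
Qed.

(** By minimality the code of [v] is a longest one in its component, so only [e0] can have the same
    rank at both ends; the choice of [z] settles that case. The last hypothesis serves to escape
    from traps when [v] is a leaf. *)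
Lemma invariant_append L v z e0 gs :
  invariant L -> perm_eq (e0 :: gs) (live L v) -> joins e0 v z ->
  (forall u, linked L v u -> size (live L v) <= size (live L u)) ->
  size (live L v) < size (live L z) \/ code L z <> code L v ->
  (size (live L v) = 1 -> escape L v) ->
  invariant (L ++ e0 :: gs).
Proof.
move=> IL sv vz vmin good lesc; have uL := inv_uniq IL.
set L' := L ++ _.
have LL' : completes L L' v.
  apply: (completes_perm uL sv) => //.
  by rewrite filter_cat (filter_new sv) filter_mem_subset ?cats0.
have e0L : e0 \notin L by move: (new_mem sv e0); rewrite mem_head => /esym /andP [].
have lv0 : live L v != [::] by move: sv; case: (live L v) => // /perm_nilP.
have lv : linked L v v by apply: connect0.
have bv : back L' v = back L v ++ e0 :: gs by rewrite back_cat (new_back_center sv).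
have bu e u : e \notin L -> joins e v u -> back L' u = rcons (back L u) e.
  by move=> eL vu; rewrite back_cat (new_back sv eL vu) cats1.
have kb u : linked L v u -> size (back L u) + size (live L u) = degree v.
  by move=> vu; rewrite size_back_live // (inv_linked_degree IL vu).
have lkv e u : e \notin L -> joins e v u -> link L v u by move=> eL vu; apply/linkP; exists e.
apply: (invariant_completes IL LL') => //.
- move=> e a b eL ab _; have eb : e \in back L b by rewrite mem_back (joins_inr ab).
  move/(separates_completes LL' eb); apply.
  by rewrite back_cat takel_cat // index_mem.
- move=> e u eL vu.
  have vu' : linked L v u by apply/connect1/lkv/vu.
  have sz : size (back L u) <= size (back L v).
    by move: (kb u vu') (kb v lv) (vmin u vu'); clear; lia.
  have eu : e \notin back L u by rewrite mem_back negb_and eL orbT.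
  have ev : e \notin back L v by rewrite mem_back negb_and eL orbT.
  have iu : index e (back L' u) = size (back L u).
    by rewrite (bu e) // -cats1 index_cat (negPf eu) /= eqxx addn0.
  have iv : index e (back L' v) = size (back L v) + index e (e0 :: gs).
    by rewrite bv index_cat (negPf ev).
  have eL' : e \in L' by case: LL' => _ _ ->; rewrite (joins_inl vu) orbT.
  case: (eqVneq (index e (back L' u)) (index e (back L' v))) => E; last first.
    apply: separates_rank => //; rewrite ?mem_back ?eL' ?(joins_inl vu) ?(joins_inr vu) //.
      by case: LL'.
    exact: completes_live LL'.
  (* Equal ranks force codes of equal length and [e = e0], hence [u = z]. *)
  move: E; rewrite iu iv => E.
  have sE : size (back L u) = size (back L v) by move: sz E; clear; lia.
  have : index e (e0 :: gs) = 0 by move: sE E; clear; lia.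
  rewrite /=; case: eqP => // e0e _; have uz : u = z.
    by move: vu; rewrite -e0e => vu; apply: joins_end vz.
  case: good => [|cne].
    by move: (kb u vu') (kb v lv); rewrite -uz sE; clear; lia.
  rewrite /separates (completes_live LL') eqxx iu /=; apply/eqP => Et; apply: cne.
  move: Et; rewrite /code (bu e) // bv map_rcons map_cat -cats1 => /(congr1 (take (size (back L u)))).
  by rewrite !take_takel // !takel_cat ?size_map ?sE // -{1}sE !take_oversize ?size_map ?sE // uz.
(* In a trap at [x], the edge [H] must be new, since the piece containing [x] meets a new edge; so
   [H] joins [v] to [x], and [t = v]. *)
move=> x vx [A [B [H [g [t [TE BE LE [xt dxt] Ct]]]]]].
have xv : x != v by apply: contra_eq_neq LE => ->; rewrite (completes_live LL').
have [y /linkP [e1 e1L vy] yx] := completes_linked_near LL' vx xv.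
have Hs : H \in e0 :: gs.
  move: TE; rewrite /touching filter_cat => /cat_rcons_mem HE.
  suff /HE : e1 \in [seq e <- e0 :: gs | [exists u, linked L' x u && (u \in ends e)]].
    by rewrite mem_filter => /andP [].
  rewrite mem_filter (new_mem sv) e1L (joins_inl vy) !andbT; apply/existsP; exists y.
  by rewrite (joins_inr vy) andbT linked_sym.
have /andP [HL vH] : (H \notin L) && (v \in ends H) by rewrite -(new_mem sv).
have tv : t = v.
  by move: vH; rewrite (joins_in _ xt) eq_sym (negPf xv) => /eqP.
rewrite {}tv in xt dxt Ct.
have vxH : joins H v x by rewrite joins_sym.
have lvx := lkv _ _ HL vxH.
have AE : A = back L x by move: BE; rewrite (bu H) // => /rcons_inj [].
(* The two are [g] and [H]; minimality then leaves [v] at most two missing edges. *)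
have kx : size (live L x) = 2 by rewrite (completes_live_near LL') ?LE // link_sym.
have kbx := kb x vx; have kbv := kb v lv.
have kv : size (live L v) <= 2 by rewrite -kx vmin.
have kv0 : 0 < size (live L v) by case: (live L v) lv0.
have dx : size (back L x) = degree x - 2 by move: kbx kx dxt; clear; lia.
rewrite {}AE /code bv map_cat in Ct.
have cx : take (degree x - 2) (code L' x) = code L x.
  by rewrite /code (bu H) // map_rcons -cats1 takel_cat ?take_oversize ?size_map ?dx.
have cL' u : linked L v u -> size (live L u) <= 2 ->
    take (degree x - 2) (code L' u) = take (degree x - 2) (code L u).
  move=> vu ku; rewrite /code back_cat map_cat takel_cat // size_map.
  by move: (kb u vu) ku dxt; clear; lia.
have linkedL u : linked L' x u -> linked L v u.
  by move=> xu; apply: connect_trans vx (completes_linked LL' xu).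
have neqv u : size (live L' u) == 1 -> u != v.
  by apply: contraTneq => ->; rewrite (completes_live LL').
have other u : size (live L' u) == 1 -> link L v u \/ size (live L u) = 1.
  move=> ku; case: (boolP (link L v u)) => [|nvu]; [by left | right].
  by rewrite -(completes_live_far LL') ?neqv 1?link_sym //; apply/eqP.
apply/or3P; case: (ltngtP (size (live L v)) 1) => [||kv1]; first by rewrite ltnNge kv0.
  (* If [v] had two missing edges, [Ct] gives [code L v = code L x] and makes [H] the second one. A
     leaf other than [x] can then only be [z], whose code differs from that of [v] by [good]. *)
  move=> kv2; case: (boolP [forall u, linked L' x u && (size (live L' u) == 1) ==> (u == x)]).
    by constructor 3.
  case/forallPn => u; rewrite negb_imply => /andP [/andP [xu ku] ux].
  have [e2 gsE] : exists e2, gs = [:: e2].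
    have : size gs = 1 by move: (perm_size sv) kv kv2 => /=; clear; lia.
    by case: (gs) => [|e2 [|? ?]] //= _; exists e2.
  rewrite gsE in sv Hs Ct.
  move/eqP: Ct; rewrite eqseq_cat ?size_map; last by move: kbx kbv kx kv kv2; clear; lia.
  case/andP => /eqP cvx /eqP [we0 wH].
  have He2 : H = e2.
    have : e2 \in [:: e0; e2] by rewrite !inE eqxx orbT.
    by rewrite (new_mem sv) => /andP [_ ve2]; apply/esym/(proper_inj ve2 vH).
  have uz : u = z.
    case: (other u ku) => [/linkP [f fL vu]|lu1]; last first.
      by have := vmin u (linkedL u xu); rewrite lu1; move: kv2; clear; lia.
    have : f \in [:: e0; e2] by rewrite (new_mem sv) fL (joins_inl vu).
    rewrite !inE => /orP [] /eqP fE; first by rewrite fE in vu; apply: joins_end vz.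
    by move: ux; rewrite fE -He2 in vu; rewrite (joins_end vu vxH) eqxx.
  rewrite {u ux}uz in xu ku.
  have kz : size (live L z) = 2.
    rewrite (completes_live_near LL') ?(eqP ku) // link_sym.
    by apply/linkP; exists e0.
  constructor 2; apply/existsP; exists z; rewrite xu cx cL' ?kz ?linkedL //.
  case: good => [|cz]; first by rewrite kz ltnNge kv2.
  rewrite -[code L x]cvx take_oversize; first exact/eqP.
  by rewrite size_map; move: (kb z (linkedL z xu)) kz dxt; clear; lia.
(* Now [v] was a leaf hanging on [x]: its component just loses [v], and each alternative of
   [escape L v] passes to [x]. *)
have only u : link L v u -> u = x by move/(leaf_link kv1)/(_ lvx).
have linkedL' u : linked L v u -> u != v -> linked L' x u.
  by move=> vu uv; have [y' /only ->] := completes_linked_near LL' vu uv.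
have big u : linked L v u -> 2 < size (live L u) -> 
    [exists u, linked L' x u && (2 < size (live L' u))].
  move=> vu ku; have uv : u != v by apply: contraTneq ku => ->; rewrite kv1.
  apply/existsP; exists u; rewrite linkedL' // (completes_live_far LL') // link_sym.
  by apply: contraTN ku => /only ->; rewrite kx.
case/or3P: (lesc kv1) => [/existsP [u /andP [vu ku]]|/existsP [u /andP [vu cu]]|/forallP vu].
- by constructor 1; apply: big vu ku.
- case: (ltnP 2 (size (live L u))) => ku; first by constructor 1; apply: big vu ku.
  constructor 2; apply/existsP; exists u.
  rewrite linkedL' //; last by apply: contraNneq cu => ->.
  rewrite cx cL' //; move: cu; rewrite dxt; apply: contraNneq => ->.
  (* By [Ct] the code of [x] is the prefix of this length of the code of [v]. *)
  have -> : degree v - 2 = size (code L x) by rewrite size_map dx dxt.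
  move/(congr1 (take (size (code L x)))): Ct.
  rewrite [RHS]take_size_cat ?size_map // takel_cat ?size_map => [->|]; first by [].
  by move: kbx kbv kx kv1; clear; lia.
- constructor 3; apply/forallP => u; apply/implyP => /andP [xu ku].
  case: (other u ku) => [/only->//|/eqP lu1].
  by have := vu u; rewrite linkedL // lu1 (negPf (neqv u ku)).
Qed.

(** * Inserting a missing edge just before the latest edge of the component *)

Section Insertion.
Variables (L L1 L2 gs : seq (edge G)) (H g : edge G) (v x t : G).
Hypotheses (IL : invariant L) (LE : L = L1 ++ H :: L2).
Hypothesis sv : perm_eq (g :: gs) (live L v).
Hypothesis L2far : forall e u, e \in L2 -> linked L v u -> u \notin ends e.
Hypotheses (xt : joins H x t) (vx : linked L v x).

Let L' := L1 ++ g :: H :: L2 ++ gs.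

Let uL : uniq L. Proof. exact: inv_uniq. Qed.

Let HL : H \in L. Proof. by rewrite LE mem_cat mem_head orbT. Qed.

Let gL : g \notin L.
Proof. by have := new_mem sv g; rewrite mem_head => /esym /andP []. Qed.

Let vg : v \in ends g.
Proof. by have := new_mem sv g; rewrite mem_head => /esym /andP []. Qed.

Lemma insertion_completes : completes L L' v.
Proof.
apply: (completes_perm uL sv).
  rewrite LE /L' -catA perm_cat2l -[g :: H :: _]/([:: g] ++ (H :: L2) ++ gs).
  by rewrite perm_catCA.
have [sub1 sub2] : {subset L1 <= L} /\ {subset L2 <= L}.
  by split=> e eL; rewrite LE mem_cat ?inE eL ?orbT.
rewrite /L' filter_cat /= (negPf gL) HL filter_cat (filter_mem_subset sub1).
have := filter_new sv; rewrite /= (negPf gL) => ->.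
by rewrite (filter_mem_subset sub2) cats0.
Qed.

Let LL' := insertion_completes.

Lemma live_nonempty : live L v != [::].
Proof. by move: sv; case: (live L v) => // /perm_nilP. Qed.

Let lx : live L x != [::].
Proof.
case: (eqVneq x v) => [->|xv]; first exact: live_nonempty.
by apply: (@linked_live _ L x v) => //; rewrite linked_sym.
Qed.

(** The other end [t] of [H] lies outside the component, because [H] is already inserted. *)
Lemma insertion_far u : linked L v u -> u != x -> u \notin ends H.
Proof.
move=> vu ux; rewrite (joins_in _ xt) negb_or ux /=; apply: contraTneq vu => ->.
apply/negP => vt; have := inv_not_linked IL HL xt => /negP; apply.
by apply: connect_trans vt; rewrite -/(linked L x v) linked_sym.
Qed.

Let L2nil u : linked L v u -> back L2 u = [::].
Proof.
move=> vu; apply/eqP; rewrite -[_ == _]negbK -has_filter; apply/hasPn => e eL.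
exact: L2far vu.
Qed.

Lemma insertion_back_old u : linked L v u -> u != x -> back L u = back L1 u.
Proof.
move=> vu ux; rewrite LE back_cat /back /= (negPf (insertion_far vu ux)).
by rewrite -/(back L2 u) L2nil // cats0.
Qed.

Lemma insertion_back_last : back L x = rcons (back L1 x) H.
Proof.
by rewrite LE back_cat {2}/back /= (joins_inl xt) -/(back L2 x) L2nil // cats1.
Qed.

Lemma insertion_touching :
  touching L x = rcons [seq e <- L1 | [exists u, linked L x u && (u \in ends e)]] H.
Proof.
rewrite /touching; set p := (X in filter X L); rewrite [in LHS]LE filter_cat /=.
have -> : filter p L2 = [::].
  apply/eqP; rewrite -[_ == _]negbK -has_filter; apply/hasPn => e eL2.
  apply/existsPn => u; apply/negP => /andP [xu]; apply/negP.
  exact: L2far eL2 (connect_trans vx xu).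
have -> : p H.
  by apply/existsP; exists x; rewrite (joins_inl xt) andbT; apply: connect0.
by rewrite cats1.
Qed.

Lemma insertion_back u :
  linked L v u -> u != x -> back L' u = back L u ++ back (g :: gs) u.
Proof.
move=> vu ux; rewrite insertion_back_old //.
rewrite -[L']/(L1 ++ [:: g] ++ [:: H] ++ L2 ++ gs) -[g :: gs]/([:: g] ++ gs) !back_cat L2nil //.
by rewrite [back [:: H] u]/back /= (negPf (insertion_far vu ux)).
Qed.

Lemma insertion_back_last_new :
  back L' x = back L1 x ++ back [:: g] x ++ H :: back gs x.
Proof.
rewrite -[L']/(L1 ++ [:: g] ++ [:: H] ++ L2 ++ gs) !back_cat L2nil //.
by rewrite [back [:: H] x]/back /= (joins_inl xt).
Qed.

(** At vertices of the component other than [x], new edges come after all old ones. At [x] only the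
    prefix ending in [H] can change, by the insertion of [g]; the first hypothesis compares it with
    the code of [t]. *)
Lemma insertion_separates e a b :
  (x \in ends g -> degree x = degree t ->
    take (size (back L1 x)).+2 (code L t) <> [seq w e | e <- back L1 x] ++ [:: w g; w H]) ->
  (x \notin ends g -> back gs x = [::]) ->
  e \in L -> joins e a b -> degree a = degree b ->
  separates L e a b -> separates L' e a b.
Proof.
move=> Hg Hgs eL ab dab sab.
have eb : e \in back L b by rewrite mem_back (joins_inr ab).
case: (boolP (linked L v b)) => [vb|vb]; last first.
  apply: (separates_completes LL' eb) => //; rewrite (completes_back LL') //.
    by apply: contraNneq vb => ->; apply: connect0.
  by apply: contraNN vb => bv; rewrite linked_sym; apply: connect1.
case: (eqVneq b x) => [bx|bx]; last first.
  by apply: (separates_completes LL' eb) => //; rewrite insertion_back // takel_cat ?index_mem.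
subst b; case: (boolP (x \in ends g)) => [xg|xg]; last first.
  apply: (separates_completes LL' eb) => //; rewrite insertion_back_last_new Hgs //.
  have -> : back [:: g] x = [::] by rewrite /back /= (negPf xg).
  by rewrite insertion_back_last /= cats1.
have gE : back [:: g] x = [:: g] by rewrite /back /= xg.
move: eb; rewrite insertion_back_last mem_rcons inE => /orP [/eqP eH|eA].
  have at_ : a = t by apply: (joins_end _ xt); rewrite -eH joins_sym.
  rewrite at_ eH in dab sab *.
  have Hx : H \notin back L1 x.
    by have := back_uniq x uL; rewrite insertion_back_last rcons_uniq => /andP [].
  have iH : index H (back L' x) = (size (back L1 x)).+1.
    rewrite insertion_back_last_new gE index_cat (negPf Hx) /= eqxx.
    case: eqP => [gH|]; last by rewrite addn1.
    by move: gL; rewrite gH HL.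
  case/andP: sab => /eqP lt _.
  rewrite /separates (completes_live_done LL' lt) eqxx iH /=.
  apply/eqP; rewrite /code (completes_back_done LL' lt) -/(code L t).
  rewrite insertion_back_last_new gE !map_cat /= => /esym E; apply: (Hg xg (esym dab)).
  rewrite E take_cat size_map; case: ltnP => [|_]; first by clear; lia.
  have -> : (size (back L1 x)).+2 - size (back L1 x) = 2 by clear; lia.
  by rewrite /= take0.
have eb : e \in back L x by rewrite insertion_back_last mem_rcons inE eA orbT.
apply: (separates_completes LL' eb) => //.
have ie : index e (back L x) < size (back L1 x).
  by rewrite insertion_back_last -cats1 index_cat eA index_mem.
move: (index e (back L x)) ie => i iA.
by rewrite insertion_back_last_new insertion_back_last -cats1 !takel_cat.
Qed.

End Insertion.

(** Here the end [x] of [H] is itself completed, in a component where all codes coincide. *)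
Lemma invariant_insert L L1 L2 gs H g x t :
  invariant L -> L = L1 ++ H :: L2 -> perm_eq (g :: gs) (live L x) ->
  (forall e u, e \in L2 -> linked L x u -> u \notin ends e) -> joins H x t ->
  (forall u, linked L x u -> code L u = code L x) ->
  (degree x = degree t ->
    take (size (back L1 x)).+2 (code L t) <> [seq w e | e <- back L1 x] ++ [:: w g; w H]) ->
  invariant (L1 ++ g :: H :: L2 ++ gs).
Proof.
move=> IL LE sx L2far xt same Hg; have uL := inv_uniq IL.
have xx : linked L x x by apply: connect0.
set L' := L1 ++ _.
have LL' : completes L L' x by apply: insertion_completes IL LE sx.
have bx := insertion_back_last LE L2far xt xx.
have bx' : back L' x = back L1 x ++ g :: H :: gs.
  have /all_filterP gE : all (fun e => x \in ends e) gs.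
    by apply/allP => e eg; have := new_mem sx e; rewrite inE eg orbT => /esym /andP [].
  rewrite (insertion_back_last_new L1 gs g L2far xt xx) /back gE /=.
  by have := new_mem sx g; rewrite mem_head => /esym /andP [_ ->].
have bu e u : e \notin L -> joins e x u -> back L' u = rcons (back L u) e.
  move=> eL xu; rewrite (insertion_back gs g IL LE L2far xt xx) ?(new_back sx eL xu) ?cats1 //.
    by apply: connect1; apply/linkP; exists e.
  by rewrite eq_sym (joins_neq xu).
have sz u : linked L x u -> size (back L u) = (size (back L1 x)).+1.
  by move/same/(congr1 size); rewrite !size_map bx size_rcons.
apply: (invariant_completes IL LL').
- exact: live_nonempty sx.
- move=> e a b; apply: (insertion_separates IL LE sx L2far xt xx) => //.
  by have := new_mem sx g; rewrite mem_head => /esym /andP [_ ->].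
- move=> e u eL xu.
  have lxu : linked L x u by apply: connect1; apply/linkP; exists e.
  have eg : e \in g :: gs by rewrite (new_mem sx) eL (joins_inl xu).
  have eL' : e \in L' by case: LL' => _ _ ->; rewrite (joins_inl xu) orbT.
  have nmem y : e \notin back L y by rewrite mem_back negb_and eL orbT.
  have eA : e \notin back L1 x by have := nmem x; rewrite bx mem_rcons inE negb_or => /andP [].
  have eH : e != H.
    by apply: contraNneq eL => ->; rewrite LE mem_cat mem_head orbT.
  apply: separates_rank => //; rewrite ?mem_back ?eL' ?(joins_inl xu) ?(joins_inr xu) //.
  - by case: LL'.
  - exact: completes_live LL'.
  (* The index of [e] at [u] is the one that [H] now has at [x]; there [g] stands before [H], and
     the other new edges after it. *)
  rewrite (bu e) // -cats1 index_cat (negPf (nmem u)) /= eqxx addn0 sz //.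
  rewrite bx' index_cat (negPf eA) /= (eq_sym H) (negPf eH).
  by case: (g == e); clear; lia.
move=> y xy [A [B [K [h [s [TE BE lE [ys dys] Cs]]]]]].
have yx : y != x by apply: contra_eq_neq lE => ->; rewrite (completes_live LL').
have [z /linkP [e1 e1L xz] zy] := completes_linked_near LL' xy yx.
(* [x] was the only vertex of the component on [H] and is now complete, so [H] no longer touches any
   remaining piece. *)
have Ks : K \in g :: gs.
  move: TE; rewrite /touching; set p := (X in filter X L').
  rewrite [in LHS]/L' filter_cat -cat1s filter_cat -(cat1s H) !filter_cat.
  have pu u : linked L' y u -> linked L x u /\ u != x.
    move=> yu; split; first exact: connect_trans xy (completes_linked LL' yu).
    apply: contraTneq (yu) => ->; rewrite linked_sym; apply/negP => xy'.
    by have := linked_live xy'; rewrite (completes_live LL') eq_sym => /(_ yx).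
  have -> : filter p L2 = [::].
    apply/eqP; rewrite -[_ == _]negbK -has_filter; apply/hasPn => e eL2.
    apply/existsPn => u; apply/negP => /andP [/pu [xu _]]; apply/negP.
    exact: L2far eL2 xu.
  have -> : filter p [:: H] = [::].
    rewrite /=; case: ifP => // /existsP [u /andP [/pu [xu ux]]].
    by rewrite (negPf (insertion_far IL LE xt xx xu ux)).
  rewrite !cat0s -filter_cat => /cat_rcons_mem HE.
  suff /HE : e1 \in filter p (g :: gs) by rewrite mem_filter => /andP [].
  rewrite mem_filter (new_mem sx) e1L (joins_inl xz) !andbT; apply/existsP; exists z.
  by rewrite (joins_inr xz) andbT linked_sym.
have /andP [KL xK] : (K \notin L) && (x \in ends K) by rewrite -(new_mem sx).
have sx' : s = x by move: xK; rewrite (joins_in _ ys) eq_sym (negPf yx) => /eqP.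
have xyK : joins K x y by rewrite joins_sym -sx'.
have AE : A = back L y by move: BE; rewrite (bu K) // => /rcons_inj [].
(* The codes of [x] and [y] agreed in [L], so right after the colours of [back L1 x] the trap
   equation compares [w g] with [w H]. *)
have gH : g = H.
  apply: (@proper_inj x); last 1 first.
  - move: Cs; rewrite sx' /code bx' AE map_cat -/(code L y) same // /code bx map_rcons -cats1.
    by rewrite -catA => /eqP; rewrite eqseq_cat // eqxx => /eqP [].
  - by have := new_mem sx g; rewrite mem_head => /esym /andP [_ ->].
  - exact: joins_inl xt.
have := new_mem sx g; rewrite mem_head => /esym /andP [].
by rewrite gH LE mem_cat mem_head orbT.
Qed.

(** At [v] the new edge has index [degree v - 1]. It is smaller at the other end: at [u != x]
    because two edges are missing there, at [x] because [g] precedes [H]. Since [H] stays the latest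
    touching edge, a new trap can only be at [x]. *)
Lemma invariant_leaf L L1 L2 H g v x t :
  invariant L -> L = L1 ++ H :: L2 -> live L v = [:: g] ->
  (forall e u, e \in L2 -> linked L v u -> u \notin ends e) -> joins H x t ->
  linked L v x -> v != x ->
  (forall u, joins g v u -> u != x -> 1 < size (live L u)) -> ~ trap L x ->
  (x \in ends g -> degree x = degree t ->
    size (live L x) = 1 \/
    take (size (back L1 x)).+1 (code L t) <> [seq w e | e <- rcons (back L1 x) g]) ->
  invariant (L1 ++ g :: H :: L2).
Proof.
move=> IL LE lvg L2far xt vx nvx Hu ntrap Hg; have uL := inv_uniq IL.
have sv : perm_eq [:: g] (live L v) by rewrite lvg.
have kv : size (live L v) = 1 by rewrite lvg.
have vv : linked L v v by apply: connect0.
rewrite -[L2]cats0; set L' := L1 ++ _.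
have LL' : completes L L' v by apply: insertion_completes IL LE sv.
have bx := insertion_back_last LE L2far xt vx.
have bx' := insertion_back_last_new L1 [::] g L2far xt vx.
have [gL vg] : g \notin L /\ v \in ends g.
  by have := new_mem sv g; rewrite mem_head => /esym /andP [].
have bv : back L' v = rcons (back L v) g.
  by rewrite (insertion_back [::] g IL LE L2far xt vx) // (new_back_center sv) cats1.
have kb u : linked L v u -> size (back L u) + size (live L u) = degree v.
  by move=> vu; rewrite size_back_live // (inv_linked_degree IL vu).
have HL : H \in L by rewrite LE mem_cat mem_head orbT.
have lx : live L x != [::] by apply: (@linked_live _ L x v); rewrite 1?linked_sym // eq_sym.
have sxt : degree x = degree t -> live L t = [::].
  move=> dxt; have tx : joins H t x by rewrite joins_sym.
  by case/andP: (inv_separates_live IL HL tx (esym dxt) lx) => /eqP.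
have ct : degree x = degree t -> size (code L t) = degree x.
  by move=> dxt; rewrite dxt -(size_back_live t uL) sxt // addn0 size_map.
apply: (invariant_completes IL LL').
- by rewrite lvg.
- move=> e a b; apply: (insertion_separates IL LE sv L2far xt vx) => // xg dxt Et.
  case: (Hg xg dxt) => [kx|]; last first.
    apply; move/(congr1 (take (size (back L1 x)).+1)): Et.
    rewrite take_takel // => ->; rewrite map_rcons -cats1 take_cat size_map ltnNge leqnSn /=.
    by rewrite subSn // subnn /=.
  have sA : (size (back L1 x)).+2 = degree x.
    by rewrite -(size_back_live x uL) kx bx size_rcons addn1.
  have lxg : live L x = [:: g].
    have : g \in live L x by rewrite mem_live gL.
    by case: (live L x) kx => [|h [|? ?]] //= _; rewrite inE => /eqP->.
  apply: ntrap.
  exists (back L1 x), [seq e <- L1 | [exists u, linked L x u && (u \in ends e)]], H, g, t.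
  split=> //; last first.
    by rewrite -Et take_oversize // ct // sA.
  exact: insertion_touching LE L2far xt vx.
- move=> e u eL vu.
  have eg : e = g.
    by apply/eqP; rewrite -mem_seq1 -lvg mem_live eL (joins_inl vu).
  rewrite {}eg {eL} in vu *.
  have lvu : linked L v u by apply: connect1; apply/linkP; exists g.
  have gL' : g \in L' by case: LL' => _ _ ->; rewrite (joins_inl vu) orbT.
  have nmem y : g \notin back L y by rewrite mem_back negb_and gL orbT.
  apply: separates_rank => //; rewrite ?mem_back ?gL' ?(joins_inl vu) ?(joins_inr vu) //.
  - by case: LL'.
  - exact: completes_live LL'.
  rewrite bv -cats1 [in X in _ != X]index_cat (negPf (nmem v)) /= eqxx addn0.
  case: (eqVneq u x) => [ux|ux]; last first.
    rewrite (insertion_back [::] g IL LE L2far xt vx) // (new_back sv gL vu) index_cat.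
    rewrite (negPf (nmem u)) /= eqxx addn0.
    move: (Hu u vu ux) (kb u lvu) (kb v vv) kv; clear.
    move: (size (live L v)) (size (live L u)) (size (back L u)) (size (back L v)) (degree v).
    by move=> a b c d f; lia.
  have xg : x \in ends g by rewrite -ux (joins_inr vu).
  have gA : g \notin back L1 x by have := nmem x; rewrite bx mem_rcons inE negb_or => /andP [].
  rewrite ux bx' index_cat (negPf gA) {2}/back /= xg /= eqxx addn0.
  have := kb x vx; rewrite bx size_rcons; move: (kb v vv) kv lx.
  by case: (live L x) => //= ? ?; clear; lia.
move=> y vy [A [B [K [h [s [TE BE lE [ys dys] Cs]]]]]].
have yv : y != v by apply: contra_eq_neq lE => ->; rewrite (completes_live LL').
have yx' : linked L' y x.
  have xv : x != v by rewrite eq_sym.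
  have [z vz zx] := completes_linked_near LL' vx xv.
  have [z' vz' zy] := completes_linked_near LL' vy yv.
  apply: connect_trans zx; rewrite -/(linked L' y z) linked_sym.
  by rewrite (leaf_link kv vz vz').
have KH : K = H.
  move: TE; rewrite /touching; set p := (X in filter X L').
  rewrite [in LHS]/L' cats0 -cat1s catA filter_cat /=.
  have -> : filter p L2 = [::].
    apply/eqP; rewrite -[_ == _]negbK -has_filter; apply/hasPn => e eL2.
    apply/existsPn => u; apply/negP => /andP [yu]; apply/negP.
    exact: L2far eL2 (connect_trans vy (completes_linked LL' yu)).
  case: ifP => [_|/existsP []]; first by move/(congr1 (last g)); rewrite last_cat last_rcons.
  by exists x; rewrite yx' (joins_inl xt).
rewrite {K}KH in TE BE ys Cs.
have yx : y = x.
  by apply: contraTeq (joins_inl ys) => yx; exact: (insertion_far IL LE xt vx vy).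
subst y.
rewrite (joins_end ys xt) in dys Cs.
rewrite /code (completes_back_done LL' (sxt dys)) -/(code L t) in Cs.
(* If [g] does not reach [x], the trap was already one in [L]; otherwise [Hg] excludes it. *)
exfalso; case: (boolP (link L x v)) => [xlv|xlv]; last first.
  rewrite (completes_back LL' yv xlv) in BE.
  rewrite (completes_live_far LL' yv xlv) in lE.
  apply: ntrap; exists A, [seq e <- L1 | [exists u, linked L x u && (u \in ends e)]], H, h, t.
  by split=> //; apply: insertion_touching LE L2far xt vx.
have xg : x \in ends g.
  case/linkP: xlv => e eL xve.
  have : e \in live L v by rewrite mem_live eL (joins_inr xve).
  by rewrite lvg inE => /eqP <-; apply: joins_inl xve.
case: (Hg xg dys) => [kx|]; first by have := completes_live_near LL' xlv; rewrite kx lE.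
apply; have AE : A = rcons (back L1 x) g.
  have gE : back [:: g] x = [:: g] by rewrite /back /= xg.
  have bxE : back L' x = rcons (rcons (back L1 x) g) H by rewrite bx' gE -!cats1 -catA.
  by move: BE; rewrite bxE => /rcons_inj [].
by rewrite Cs AE take_size_cat // size_map size_rcons.
Qed.

(** * Every incomplete order can be extended *)

Lemma last_touching L v :
  invariant L -> live L v != [::] ->
  exists L1 L2 H x t, [/\ L = L1 ++ H :: L2,
    forall e u, e \in L2 -> linked L v u -> u \notin ends e, joins H x t & linked L v x].
Proof.
move=> IL lv; have [u vu bu] := inv_back IL lv.
have [T0|[B [H TE]]] : touching L v = [::] \/ exists B H, touching L v = rcons B H.
  by case/lastP: (touching L v) => [|B H]; [left | right; exists B, H].
  case bE: (back L u) bu => [//|e s] _.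
  have := mem_head e s; rewrite -bE mem_back => /andP [ue eL].
  suff : e \in touching L v by rewrite T0.
  by rewrite mem_filter eL andbT; apply/existsP; exists u; rewrite vu.
have : H \in touching L v by rewrite TE mem_rcons mem_head.
rewrite mem_filter => /andP [/existsP [x /andP [vx /in_joins [t xt]]] _].
case: (rcons_filter_split TE) => L1 [L2 [LE _ E2]].
exists L1, L2, H, x, t; split=> // e y eL2 vy; apply/negP => ye.
suff : e \in [::] by [].
by rewrite -E2 mem_filter eL2 andbT; apply/existsP; exists y; rewrite vy.
Qed.

Lemma linked_closed L (P : G -> Prop) v u :
  (forall a b, linked L v a -> P a -> link L a b -> P b) -> P v -> linked L v u -> P u.
Proof.
move=> PP Pv /connectP [p pp ->].
suff last_P a : linked L v a -> P a -> path (link L) a p -> P (last a p).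
  by apply: last_P => //; apply: connect0.
elim: p {pp} a => //= b p IH a va Pa /andP [ab pp].
apply: IH => //; first exact: linked_trans va (connect1 ab).
exact: PP va Pa ab.
Qed.

Lemma leaf_pair L v u x :
  size (live L v) = 1 -> size (live L u) = 1 -> link L v u -> linked L v x ->
  x = v \/ x = u.
Proof.
move=> kv ku vu; apply: (linked_closed (P := fun y => y = v \/ y = u)); last by left.
move=> a b _ [->|->] ab; first by right; apply: leaf_link kv ab vu.
by left; apply: leaf_link ku ab _; rewrite link_sym.
Qed.

Lemma size1_mem (T : eqType) (s : seq T) : size s = 1 -> exists a, s = [:: a].
Proof. by case: s => [|a [|? ?]] // _; exists a. Qed.

Definition extendable L := exists2 L', invariant L' & size L < size L'.

(* If [g] and [g2] both end at [x], then at most one of [w g], [w g2] can be the colour of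
   rank [size (back L1 x) + 1] at [t]. *)
Lemma extendable_leaf L v :
  invariant L -> size (live L v) = 1 -> ~~ escape L v -> extendable L.
Proof.
move=> IL kv; rewrite /escape !negb_or => /and3P [/existsPn k2 /existsPn same /forallPn [v2]].
rewrite negb_imply => /andP [/andP [vv2 /eqP kv2] v2v].
have lv : live L v != [::] by case: (live L v) kv.
have [L1 [L2 [H [x [t [LE L2far xt vx]]]]]] := last_touching IL lv.
have vv : linked L v v by apply: connect0.
have k1 u : linked L v u -> 0 < size (live L u).
  move=> vu; case: (eqVneq u v) => [->|uv]; first by rewrite kv.
  have uv' : linked L u v by rewrite linked_sym.
  by have := linked_live uv' uv; case: (live L u).
(* An escape of [x] would be one of [v], as component and degree are the same, or would force both
   leaves [v] and [v2] to equal [x]. *)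
have ntrap : ~ trap L x.
  move/(inv_trap IL) => /or3P [/existsP [u /andP [xu ku]]|/existsP [u /andP [xu cu]]|/forallP only].
  - by have := k2 u; rewrite ku andbT (linked_trans vx xu).
  - have := same u; rewrite (linked_trans vx xu) negbK => /eqP su.
    have := same x; rewrite vx negbK (inv_linked_degree IL vx) => /eqP sx.
    by move: cu; rewrite -(inv_linked_degree IL vx) in su sx *; rewrite su sx eqxx.
  have xv : linked L x v by rewrite linked_sym.
  have := only v; have := only v2; rewrite xv kv kv2 (linked_trans xv vv2) /=.
  by move=> /eqP v2x /eqP vx'; rewrite v2x -vx' eqxx in v2v.
(* Any leaf [y] other than [x] will do: a neighbour [u != x] that is a leaf too would make [y] and
   [u] the whole component, leaving no room for [x]. *)
have leafP y g : linked L v y -> live L y = [:: g] -> y != x ->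
    (x \in ends g -> degree x = degree t -> size (live L x) = 1 \/
      take (size (back L1 x)).+1 (code L t) <> [seq w e | e <- rcons (back L1 x) g]) ->
    extendable L.
  move=> vy ly yx Hg; have yv : linked L y v by rewrite linked_sym.
  have yx' : linked L y x := linked_trans yv vx.
  have ky : size (live L y) = 1 by rewrite ly.
  exists (L1 ++ g :: H :: L2); last by rewrite LE !size_cat /= !addnS.
  apply: (invariant_leaf IL LE ly _ xt yx' yx _ ntrap Hg).
    by move=> e u eL2 yu; exact: (L2far e u eL2 (linked_trans vy yu)).
  move=> u yu ux; have gL : g \notin L.
    by have := mem_head g [::]; rewrite -ly mem_live => /andP [].
  have lyu : link L y u by apply/linkP; exists g.
  have := k1 u (linked_trans vy (connect1 lyu)); rewrite leq_eqVlt => /orP [/eqP ku|//].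
  case: (leaf_pair ky (esym ku) lyu yx') => E; first by rewrite E eqxx in yx.
  by rewrite E eqxx in ux.
have [g lg] := size1_mem kv; have [g2 lg2] := size1_mem kv2.
have [gv g2v] : v \in ends g /\ v2 \in ends g2.
  by split; [have := mem_head g [::]; rewrite -lg|have := mem_head g2 [::]; rewrite -lg2];
    rewrite mem_live => /andP [].
case: (eqVneq (size (live L x)) 1) => [kx|kx].
  case: (eqVneq v x) => [vx'|vx']; last by apply: leafP lg vx' _ => //; left.
  apply: (leafP v2 g2) => //; [by rewrite -vx' | by move=> _ _; left].
have vx' : v != x by apply: contra_neq kx => <-.
have v2x : v2 != x by apply: contra_neq kx => <-.
case: (boolP (x \in ends g)) => [xg|xg]; last by apply: leafP lg vx' _ => //; rewrite (negPf xg).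
case: (boolP (x \in ends g2)) => [xg2|xg2]; last first.
  by apply: (leafP _ _ _ lg2 v2x) => //; rewrite (negPf xg2).
case: (eqVneq (take (size (back L1 x)).+1 (code L t)) [seq w e | e <- rcons (back L1 x) g]) => [E|/eqP E].
  apply: (leafP _ _ _ lg2 v2x) => // _ _; right; rewrite E !map_rcons => /rcons_inj [] wg.
  have gg2 : g = g2 := proper_inj xg xg2 wg.
  rewrite -gg2 in g2v; have xv : x != v by rewrite eq_sym.
  have xv2 : x != v2 by rewrite eq_sym.
  by rewrite (joins_end (in2_joins xg g2v xv2) (in2_joins xg gv xv)) eqxx in v2v.
by apply: leafP lg vx' _ => // _ _; right.
Qed.

Lemma extendable_append L v z :
  invariant L -> (forall u, linked L v u -> size (live L v) <= size (live L u)) ->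
  link L v z -> size (live L v) < size (live L z) \/ code L z <> code L v ->
  (size (live L v) = 1 -> escape L v) -> extendable L.
Proof.
move=> IL vmin /link_live [e vz ev] good esc.
exists (L ++ e :: rem e (live L v)); last by rewrite size_cat /= addnS ltnS leq_addr.
apply: (invariant_append IL _ vz) => //.
by rewrite perm_sym perm_to_rem.
Qed.

(** [x] has at least two missing edges, and the code of [t] can rule out at most one of them as the
    edge put before [H]. *)
Lemma extendable_uniform L v :
  invariant L -> live L v != [::] ->
  (forall u, linked L v u -> size (live L u) = size (live L v) /\ code L u = code L v) ->
  (size (live L v) = 1 -> escape L v) -> extendable L.
Proof.
move=> IL lv same esc.
have [L1 [L2 [H [x [t [LE L2far xt vx]]]]]] := last_touching IL lv.
(* Otherwise [v] and its neighbour are both leaves with equal codes, which contradicts every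
   alternative of [escape L v]. *)
have kx : size (live L x) != 1.
  have [kx _] := same x vx; rewrite kx; apply/eqP => kv.
  case/or3P: (esc kv) => [/existsP [u /andP [vu]]|/existsP [u /andP [vu]]|/forallP only].
  - by have [-> _] := same u vu; rewrite kv.
  - by have [_ ->] := same u vu; rewrite eqxx.
  have [e le] := size1_mem kv; have := mem_head e [::].
  rewrite -le => /live_link [u vu lvu]; have := only u.
  have vu' : linked L v u := connect1 lvu.
  have [-> _] := same u vu'; rewrite vu' kv /= eq_sym.
  by rewrite (negPf (joins_neq vu)).
have good g : g \in live L x ->
    (degree x = degree t -> take (size (back L1 x)).+2 (code L t) <>
      [seq w e | e <- back L1 x] ++ [:: w g; w H]) -> extendable L.
  move=> gx Hg; exists (L1 ++ g :: H :: L2 ++ rem g (live L x)).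
    apply: (invariant_insert IL LE _ _ xt _ Hg).
    - by rewrite perm_sym perm_to_rem.
    - by move=> e u eL2 xu; exact: (L2far e u eL2 (linked_trans vx xu)).
    move=> u xu; have [_ ->] := same x vx.
    by have [] := same u (linked_trans vx xu).
  by rewrite LE !size_cat /= size_cat; clear; lia.
have := live_uniq L x; have kv : live L x != [::].
  by have [kx' _] := same x vx; move: lv; rewrite -!size_eq0 kx'.
case lxE: (live L x) kx kv => [|g [|g2 s]] //= _ _ /andP []; rewrite inE negb_or => /andP [gg2 _] _.
have [gx g2x] : g \in live L x /\ g2 \in live L x by rewrite lxE !inE !eqxx orbT.
case: (eqVneq (take (size (back L1 x)).+2 (code L t))
              ([seq w e | e <- back L1 x] ++ [:: w g; w H])) => [E|/eqP E].
  apply: (good g2) => // _; rewrite E => /eqP; rewrite eqseq_cat // eqxx => /eqP [] wg.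
  move: gx g2x; rewrite !mem_live => /andP [_ gx] /andP [_ g2x].
  by rewrite (proper_inj gx g2x wg) eqxx in gg2.
exact: (good g).
Qed.

(** Leaves without an escape are treated first, then vertices with fewest missing edges that have a
    suitable first edge to append; failing both, the component is uniform. *)
Lemma invariant_step L v : invariant L -> live L v != [::] -> extendable L.
Proof.
move=> IL lv0.
case: (boolP [exists u, [&& linked L v u, size (live L u) == 1 & ~~ escape L u]]).
  by case/existsP => u /and3P [_ /eqP ku eu]; apply: extendable_leaf ku eu.
move/existsPn => esc.
have vv : linked L v v by apply: connect0.
case: (arg_minnP (fun u => size (live L u)) vv) => m vm mmin.
have mv : linked L m v by rewrite linked_sym.
pose good a b := link L a b &&
  ((size (live L a) < size (live L b)) || (code L b != code L a)).
case: (boolP [exists a, exists b,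
  [&& linked L v a, size (live L a) == size (live L m) & good a b]]).
  case/existsP => a /existsP [b /and4P [va /eqP ka ab gab]].
  apply: extendable_append ab _ _ => //.
  - by move=> u au; rewrite ka; apply: mmin; apply: linked_trans va au.
  - by case/orP: gab => [|/eqP]; [left | right].
  by move=> k1; have := esc a; rewrite va k1 /= negbK.
move/existsPn => bad.
have lm : live L m != [::].
  case: (eqVneq m v) => [->//|mv']; exact: linked_live mv mv'.
apply: extendable_uniform lm _ _ => //.
  (* Without a good pair, a neighbour of a minimal vertex is again minimal and has the same code, so
     this spreads from [m] over the component. *)
  move=> u; apply: (linked_closed (P := fun y =>
    size (live L y) = size (live L m) /\ code L y = code L m)) => //.
  move=> a b ma [ka ca] ab; have va := linked_trans vm ma.
  have /existsPn /(_ b) := bad a; rewrite va ka eqxx /good ab /= negb_or negbK -leqNgt.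
  case/andP => kb /eqP ->; split=> //; apply/eqP; rewrite eqn_leq -{1}ka kb /=.
  by apply: mmin; apply: linked_trans va (connect1 ab).
by move=> k1; have := esc m; rewrite vm k1 /= negbK.
Qed.

(** * Starting and finishing *)

Definition unbalanced e := [exists u, exists v, joins e u v && (degree u != degree v)].

Lemma unbalanced_degree e u v : joins e u v -> unbalanced e = (degree u != degree v).
Proof.
move=> uv; apply/existsP/idP => [[a /existsP [b /andP [ab dab]]]|duv]; last first.
  by exists u; apply/existsP; exists v; rewrite uv.
have := joins_inl ab; rewrite (joins_in _ uv) => /orP [] /eqP au.
  by rewrite au in ab dab; rewrite (joins_end uv ab).
by rewrite au in ab dab; rewrite joins_sym in uv; rewrite (joins_end uv ab) eq_sym.
Qed.

(** No edge with ends of equal degrees is inserted yet, so separation is vacuous and there are no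
    traps. *)
Lemma invariant_start :
  connected_graph G -> ~ regular_graph G -> invariant [seq e <- enum (edge G) | unbalanced e].
Proof.
move=> conn nreg; set L := filter _ _.
have memL e : (e \in L) = unbalanced e by rewrite mem_filter mem_enum andbT.
split.
- by rewrite filter_uniq ?enum_uniq.
- by move=> e u v; rewrite memL => + uv; rewrite (unbalanced_degree uv) => /eqP.
- by move=> e u v; rewrite memL => + uv; rewrite (unbalanced_degree uv) negbK => /eqP.
(* A component that meets no inserted edge has no unbalanced edge leaving it, so by connectedness it
   is all of [G], with constant degree. *)
- move=> v _; case: (boolP [exists u, linked L v u && (back L u != [::])]).
    by case/existsP => u /andP []; exists u.
  move/existsPn => none; case: nreg; exists (degree v) => u.
  have [] : linked L v u /\ degree u = degree v; last by [].
  case/connectP: (conn v u) => p pp ->.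
  suff last_p a : linked L v a -> degree a = degree v -> path (@adj G) a p ->
      linked L v (last a p) /\ degree (last a p) = degree v.
    by apply: last_p => //; apply: connect0.
  elim: p {pp} a => //= b p IH a va da /andP [/adj_joins [e ab] pp].
  have eL : e \notin L.
    apply/negP => eL; have := none a; rewrite va negbK => /eqP ba.
    suff : e \in back L a by rewrite ba.
    by rewrite mem_back (joins_inl ab).
  have dab : degree a = degree b.
    by move: eL; rewrite memL (unbalanced_degree ab) negbK => /eqP.
  apply: IH; rewrite -?dab //; apply: linked_trans va (connect1 _).
  by apply/linkP; exists e.
move=> x [A [B [H [g [t [_ BE _ [xt dxt] _]]]]]].
have : H \in back L x by rewrite BE mem_rcons mem_head.
by rewrite mem_back memL (unbalanced_degree xt) dxt eqxx andbF.
Qed.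

Lemma invariant_finish L :
  invariant L -> exists2 L', invariant L' & forall v, live L' v = [::].
Proof.
have [n] := ubnP (#|edge G| - size L); elim: n L => // n IH L lt_n IL.
case: (boolP [exists v, live L v != [::]]) => [/existsP [v lv]|/existsPn done].
  have [L' IL' lt] := invariant_step IL lv.
  have le : size L' <= #|edge G|.
    by rewrite -(card_uniqP (inv_uniq IL')) max_card.
  by apply: (IH L') => //; move: lt_n lt le; clear; lia.
by exists L => // v; apply/eqP; have := done v; rewrite negbK.
Qed.

Lemma orderable_eqType :
  connected_graph G -> ~ regular_graph G -> sequentially_orderable w.
Proof.
move=> conn nreg; have [L IL Ldone] := invariant_finish (invariant_start conn nreg).
have uL := inv_uniq IL.
have memL e : e \in L.
  have [u [v /andP [_ uv]]] := edge_ends e.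
  exact: (live_nil L u).1 (Ldone u) e (joins_inl uv).
pose r : rel (edge G) := fun e f => index e L <= index f L.
have r_trans : transitive r by move=> ? ? ?; apply: leq_trans.
have r_anti : antisymmetric r.
  move=> e f; rewrite /r -eqn_leq => /eqP E.
  by rewrite -[e](nth_index e (memL e)) E nth_index.
have r_total : total r by move=> e f; apply: leq_total.
have rL : sorted r L.
  case LE: {1}L => [//|e s]; rewrite -LE; apply/(sortedP e) => i i_s.
  by rewrite /r !index_uniq // ltnW.
exists r; first by split=> // e; apply: leqnn.
have codeE v : induced_colouring w r v = code L v.
  congr map; apply: (sorted_eq r_trans r_anti).
  - exact: sort_sorted.
  - exact: sorted_filter.
  rewrite perm_sort; apply: uniq_perm; rewrite ?enum_uniq ?back_uniq // => e.
  by rewrite mem_enum inE mem_back memL andbT.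
move=> u v /adj_joins [e uv]; rewrite !codeE.
case: (eqVneq (degree u) (degree v)) => [duv|/eqP duv E].
  case/orP: (inv_separates IL (memL e) uv duv) => /separates_neq // E E'.
  exact: E.
apply: duv; move/(congr1 size): E; rewrite !size_map.
by rewrite -!(size_back_live _ uL) !Ldone !addn0.
Qed.

End Colouring.

Theorem corollary6 (G : sgraph) (C : Type) (w : edge G -> C) :
  connected_graph G -> ~ regular_graph G ->
  proper_edge_colouring w -> sequentially_orderable w.
Proof.
move=> conn nreg wP.
(* Equality on [C] need not be decidable, so each colour is replaced by its set of edges; [h] is
   injective on the colours that occur. *)
pose h (c : C) : {set edge G} := [set e | excluded_middle_informative (c = w e)].
have hP e f : h (w e) = h (w f) -> w e = w f.
  move/setP/(_ f); rewrite !inE.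
  by do 2![case: excluded_middle_informative => //].
have hwP : proper_edge_colouring (h \o w).
  by move=> e f v ef ve vf /hP; apply: wP ef ve vf.
have [r r_order rP] := orderable_eqType hwP conn nreg.
have colourE v : induced_colouring (h \o w) r v = map h (induced_colouring w r v).
  by rewrite /induced_colouring -map_comp.
by exists r => // u v uv E; apply: (rP u v uv); rewrite !colourE E.
Qed.
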